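(* Let $f:\mathbb{R}\to\mathbb{R}$ be a continuous function for which there exist constants $C>0$ and $\delta>0$ such that: (i) $f(0)=0$; (ii) $u\cdot f(u)<0$ for every $u\in[-\delta,0)\cup(0,\delta]$; (iii) for all $u,v\in[-\delta,0)\cup(0,\delta]$ with $u\cdot v>0$, $$|f(u)-f(v)|\le \frac{C}{\sqrt{\min\{|u|,|v|\}}}\,|u-v|.$$ Let $r_0\ge 1$. Then, given $\psi_1>0$, the initial value problem $$\psi''+\frac{\psi'}{r}+f(\psi)=0,\quad r\ge r_0,\qquad \psi'(r_0)=\psi_1,\qquad \psi(r_0)=0,$$ has a unique solution to the right of $r_0$.
   Context: The unknown $\psi=\psi(r)$ is a real-valued function of the real variable $r$, and primes denote derivatives with respect to $r$. The numbers $r_0$ and $\psi_1$ are real. *)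

(* Defs.v *)
From Stdlib Require Import Reals.
Open Scope R_scope.

Definition punctured (delta u : R) : Prop :=
  (-delta <= u < 0) \/ (0 < u <= delta).

Definition Ico (a b r : R) : Prop := a <= r < b.

(* [D_in g g' D r] is differentiability relative to [D]: on [Ico r0 r1] it is
   the right derivative at [r0] and the ordinary derivative at interior points.
   The equation forces [d2psi] to be continuous, so solutions are C^2 on
   [Ico r0 r1].  The values of [psi] outside [Ico r0 r1] are irrelevant. *)
Definition is_solution (f : R -> R) (r0 psi1 r1 : R) (psi : R -> R) : Prop :=
  exists dpsi d2psi : R -> R,
    (forall r, Ico r0 r1 r ->
       D_in psi dpsi (Ico r0 r1) r /\
       D_in dpsi d2psi (Ico r0 r1) r /\
       d2psi r + dpsi r / r + f (psi r) = 0) /\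
    dpsi r0 = psi1 /\
    psi r0 = 0.

(* Main.v *)
(** The slope [p = psi'] satisfies [r p(r) = r0 psi1 - \int_{r0}^r s f(psi(s)) ds]
    with [psi(r) = \int_{r0}^r p].  As long as [psi1/4 <= p <= 2 psi1], the
    distance from [psi(r)] to the singularity of [f] at [0] is at least
    [psi1/4 * (r - r0)], while two candidate solutions differ by at most
    [(r - r0) sup |p - q|].  Hence (iii) gives
    [|f(psi) - f(phi)| <= C (psi1/4)^(-1/2) (r - r0)^(1/2) sup |p - q|],
    and the fixed point equation for the slope is a contraction on a short
    interval.  For uniqueness, a continuity argument shows that the slope of any
    solution stays in [[psi1/4, 2 psi1]]. *)

Require Import Defs.
From Stdlib Require Import Reals Lra Psatz.
From Coquelicot Require Import Coquelicot.
Open Scope R_scope.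

(** * Derivatives relative to a half-open interval *)

Lemma D_in_continuous (g dg : R -> R) (a b x e : R) :
  D_in g dg (Ico a b) x -> 0 < e ->
  exists alp, 0 < alp /\
    forall y, Ico a b y -> Rabs (y - x) < alp -> Rabs (g y - g x) < e.
Proof.
  intros H He.
  destruct (cont_deriv _ _ _ _ H e He) as [alp [Ha Hy]].
  exists alp. split; [exact Ha|].
  intros y Iy Hd. destruct (Req_dec x y) as [->|Hne].
  - rewrite Rminus_diag, Rabs_R0. exact He.
  - apply (Hy y). split; [split; assumption|exact Hd].
Qed.

Lemma D_in_interior (g dg : R -> R) (a b x : R) :
  a < x < b -> D_in g dg (Ico a b) x -> derivable_pt_lim g x (dg x).
Proof.
  intros Hx H e He.
  destruct (H e He) as [alp [Ha Hy]].
  assert (Hm : 0 < Rmin alp (Rmin (x - a) (b - x))) by (repeat apply Rmin_pos; lra).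
  exists (mkposreal _ Hm). intros h Hh0 Hh. simpl in Hh.
  pose proof (Rmin_l alp (Rmin (x - a) (b - x))).
  pose proof (Rmin_r alp (Rmin (x - a) (b - x))).
  pose proof (Rmin_l (x - a) (b - x)). pose proof (Rmin_r (x - a) (b - x)).
  destruct (Rabs_def2 h _ Hh).
  specialize (Hy (x + h)). simpl in Hy. unfold Rdist in Hy.
  replace (x + h - x) with h in Hy by ring.
  apply Hy. split; [split|]; [split; lra|lra|lra].
Qed.

Lemma is_derive_D_in (g dg : R -> R) (D : R -> Prop) (x : R) :
  is_derive g x (dg x) -> D_in g dg D x.
Proof.
  intros H. apply is_derive_Reals, derivable_pt_lim_D_in in H.
  unfold D_in in *. eapply limit1_imp; [|exact H].
  intros y [_ Hy]. split; [exact I|exact Hy].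
Qed.

Lemma D_in_mean_value (g dg : R -> R) (a b r : R) :
  (forall x, Ico a b x -> D_in g dg (Ico a b) x) -> a < r < b ->
  exists c, a < c < r /\ g r - g a = dg c * (r - a).
Proof.
  intros H Hr.
  (* Extending [g] by the constant [g a] to the left of [a] gives the two-sided continuity at [a]
     that [MVT] requires; nothing is known about [g] itself there. *)
  set (h := fun x => g (Rmax x a)).
  assert (Hc : forall c, a <= c <= r -> continuity_pt h c).
  { intros c Hc e He.
    destruct (D_in_continuous g dg a b c e (H c ltac:(split; lra)) He) as [alp [Ha Hy]].
    exists (Rmin alp (b - c)). split; [apply Rmin_pos; lra|].
    intros y [_ Hd]. simpl in *. unfold Rdist, h in *.
    pose proof (Rmin_l alp (b - c)). pose proof (Rmin_r alp (b - c)).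
    destruct (Rabs_def2 _ _ Hd).
    rewrite (Rmax_left c a) by lra.
    unfold Rmax; destruct (Rle_dec y a); apply Hy; try (split; lra);
      apply Rabs_def1; lra. }
  assert (Hd : forall c, a < c < r -> derivable_pt_lim h c (dg c)).
  { intros c Hc'. apply is_derive_Reals.
    apply (is_derive_ext_loc g).
    - exists (mkposreal (c - a) ltac:(lra)). intros y Hy.
      apply Rabs_def2 in Hy. unfold minus, plus, opp in Hy; simpl in Hy.
      unfold h. rewrite Rmax_left; [reflexivity|lra].
    - apply is_derive_Reals. apply (D_in_interior g dg a b); [lra|].
      apply H. split; lra. }
  destruct (MVT h id a r (fun c Hc' => exist _ (dg c) (Hd c Hc'))
      (fun c _ => derivable_pt_id c) ltac:(lra) Hc
      (fun c _ => derivable_continuous_pt _ _ (derivable_pt_id c))) as [c [P E]].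
  exists c. split; [exact P|].
  rewrite derive_pt_id in E. simpl in E. unfold h, id in E.
  rewrite !Rmax_left in E by lra. lra.
Qed.

(** * Increments and primitives on the whole line *)

Lemma is_derive_increment (F f : R -> R) (a r : R) :
  (forall x, is_derive F x (f x)) -> a <= r ->
  exists c, a <= c <= r /\ F r - F a = f c * (r - a).
Proof.
  intros H Hr.
  destruct (MVT_gen F a r f) as [c [Hc E]].
  - intros; apply H.
  - intros x _. apply continuity_pt_filterlim.
    apply (ex_derive_continuous F). eexists; apply H.
  - rewrite Rmin_left, Rmax_right in Hc by lra. eauto.
Qed.

Lemma is_derive_primitive (g : R -> R) (a x : R) :
  continuity g -> is_derive (fun y => RInt g a y) x (g x).
Proof.
  intros H.
  assert (Hc : forall y, continuous g y)
    by (intros y; apply continuity_pt_filterlim, H).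
  apply (is_derive_RInt g _ a); [|apply Hc].
  apply filter_forall. intros y. apply (RInt_correct (V := R_CompleteNormedModule)), ex_RInt_continuous.
  intros; apply Hc.
Qed.

Lemma continuity_primitive (g : R -> R) (a : R) :
  continuity g -> continuity (fun y => RInt g a y).
Proof.
  intros H x. apply continuity_pt_filterlim.
  apply (ex_derive_continuous (fun y => RInt g a y)). eexists.
  now apply is_derive_primitive.
Qed.

(* Continuous induction: [g] cannot leave [a, b] because whenever it has stayed
   there up to time [r], it is in the interior at time [r]. *)
Lemma bootstrap_bounds (g dg : R -> R) (r0 r1 a b : R) :
  (forall x, Ico r0 r1 x -> D_in g dg (Ico r0 r1) x) ->
  (forall r, Ico r0 r1 r -> (forall s, r0 <= s < r -> a <= g s <= b) -> a < g r < b) ->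
  forall r, Ico r0 r1 r -> a <= g r <= b.
Proof.
  intros Hg Hstep r [Hr0 Hr1].
  set (E := fun x => r0 <= x <= r /\ forall s, r0 <= s < x -> a <= g s <= b).
  destruct (completeness E) as [m [Hub Hlub]].
  { exists r. intros x [Hx _]. lra. }
  { exists r0. split; [lra|]. intros; lra. }
  assert (Hm0 : r0 <= m). { apply Hub. split; [lra|]. intros; lra. }
  assert (Hmr : m <= r). { apply Hlub. intros x [Hx _]; lra. }
  assert (Hbelow : forall s, r0 <= s < m -> a <= g s <= b).
  (* A time [s < m] at which a bound fails would be an upper bound of [E] below its supremum [m]. *)
  { intros s Hs. destruct (Rle_or_lt (a) (g s)) as [Ha|Ha];
      [destruct (Rle_or_lt (g s) b) as [Hb|Hb]; [lra|]|]; exfalso.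
    all: assert (m <= s); [apply Hlub; intros x [Hx Hxs];
         destruct (Rle_or_lt x s); [assumption|]; specialize (Hxs s); lra | lra]. }
  assert (Hm : a < g m < b). { apply Hstep; [split; lra|exact Hbelow]. }
  destruct (Req_dec m r) as [->|Hne]; [lra|exfalso].
  (* If [m < r], continuity at [m] carries the bounds on to [m + Rmin alp (r - m)], which then lies
     in [E], beyond its supremum. *)
  destruct (D_in_continuous g dg r0 r1 m (Rmin (g m - a) (b - g m))
     (Hg m ltac:(split; lra)) ltac:(apply Rmin_pos; lra)) as [alp [Ha Hy]].
  pose proof (Rmin_l (g m - a) (b - g m)). pose proof (Rmin_r (g m - a) (b - g m)).
  pose proof (Rmin_l alp (r - m)). pose proof (Rmin_r alp (r - m)).
  assert (0 < Rmin alp (r - m)) by (apply Rmin_pos; lra).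
  assert (m + Rmin alp (r - m) <= m); [|lra].
  apply Hub. split; [lra|]. intros s Hs.
  destruct (Rlt_or_le s m); [apply Hbelow; lra|].
  assert (Hgs := Hy s ltac:(split; lra) ltac:(rewrite Rabs_pos_eq; lra)).
  destruct (Rabs_def2 _ _ Hgs). lra.
Qed.

(** * Halving estimates and a fixed point theorem *)

(** Stands in for an argument with the supremum norm: halving a crude bound [B] again and again
    forces a difference to vanish. *)
Lemma nonpos_of_le_half_pow (x B : R) :
  (forall n, x <= B * (/ 2) ^ n) -> x <= 0.
Proof.
  intros H.
  assert (L : is_lim_seq (fun n => B * (/ 2) ^ n) (B * 0)).
  { apply (is_lim_seq_scal_l _ B 0). apply is_lim_seq_geom.
    rewrite Rabs_pos_eq; lra. }
  rewrite Rmult_0_r in L.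
  apply (is_lim_seq_le (fun _ => x) _ x 0 H (is_lim_seq_const x) L).
Qed.

Lemma half_pow_small (B e : R) :
  0 <= B -> 0 < e -> exists N, forall n, (N <= n)%nat -> B * (/ 2) ^ n < e.
Proof.
  intros HB He.
  assert (He' : 0 < e / (B + 1)) by (apply Rdiv_lt_0_compat; lra).
  destruct (pow_lt_1_zero (/ 2) ltac:(rewrite Rabs_pos_eq; lra) _ He') as [N HN].
  exists N. intros n Hn. specialize (HN n Hn).
  assert (Hq : 0 < (/ 2) ^ n) by (apply pow_lt; lra).
  rewrite Rabs_pos_eq in HN by lra.
  replace e with ((B + 1) * (e / (B + 1))) by (field; lra).
  apply Rle_lt_trans with ((B + 1) * (/ 2) ^ n); [nra|].
  apply Rmult_lt_compat_l; [lra|exact HN].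
Qed.

Lemma iter_in (S : (R -> R) -> Prop) (T : (R -> R) -> R -> R) (p : R -> R) :
  (forall q, S q -> S (T q)) -> S p -> forall n, S (Nat.iter n T p).
Proof. intros HT Hp n. induction n; simpl; auto. Qed.

(** Banach's theorem for continuous functions with values in [[a, b]]. The uniform distance appears
    only through its upper bounds [d]. The iterates of the constant [a] are uniformly Cauchy, so
    their pointwise limit is uniform and hence continuous. *)
Lemma half_contraction_fixed_point (a b : R) (T : (R -> R) -> R -> R) :
  let S := fun p : R -> R => continuity p /\ forall x, a <= p x <= b in
  a <= b ->
  (forall p, S p -> S (T p)) ->
  (forall p q d, S p -> S q -> (forall x, Rabs (p x - q x) <= d) ->
     forall x, Rabs (T p x - T q x) <= d / 2) ->
  exists p, S p /\ forall x, T p x = p x.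
Proof.
  intros S Hab HT Hc.
  set (u := fun n => Nat.iter n T (fun _ => a)).
  assert (S0 : S (fun _ => a)).
  { split; [|intros; lra]. intros x. apply continuity_const. now intros ? ?. }
  assert (HS : forall n, S (u n)). { apply (iter_in S); assumption. }
  assert (Hit : forall n p q, S p -> S q -> forall x,
     Rabs (Nat.iter n T p x - Nat.iter n T q x) <= (b - a) * (/ 2) ^ n).
  { intros n p q Hp Hq. induction n as [|n IH]; intros x; simpl.
    - destruct Hp as [_ Hp], Hq as [_ Hq]. specialize (Hp x); specialize (Hq x).
      apply Rabs_le. lra.
    - eapply Rle_trans; [apply (Hc _ _ ((b - a) * (/ 2) ^ n))|lra];
        [now apply (iter_in S)|now apply (iter_in S)|exact IH]. }
  assert (Hcau : forall n k x, Rabs (u (n + k)%nat x - u n x) <= (b - a) * (/ 2) ^ n).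
  (* [u (n + k)] is the [n]-fold iterate started at [u k], so [Hit] compares it with [u n]. *)
  { intros n k x. unfold u. rewrite Nat.iter_add. apply Hit; [apply HS|exact S0]. }
  assert (Hlim : forall x, ex_finite_lim_seq (fun n => u n x)).
  { intros x. apply ex_lim_seq_cauchy_corr. intros e.
    destruct (half_pow_small (b - a) (e / 2)) as [N HN];
      [lra|apply is_pos_div_2|].
    exists N.
    assert (Hq : forall n, (N <= n)%nat -> Rabs (u n x - u N x) < e / 2).
    { intros n Hn. replace n with (N + (n - N))%nat by lia.
      eapply Rle_lt_trans; [apply Hcau|]. apply HN; lia. }
    intros n m Hn Hm. generalize (Hq n Hn) (Hq m Hm). intros H1 H2.
    apply Rabs_def2 in H1, H2. apply Rabs_def1; lra. }
  set (p := fun x => real (Lim_seq (fun n => u n x))).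
  assert (Hp : forall x, is_lim_seq (fun n => u n x) (p x)).
  { intros x. apply Lim_seq_correct', Hlim. }
  assert (Hup : forall n x, Rabs (p x - u n x) <= (b - a) * (/ 2) ^ n).
  { intros n x.
    apply (is_lim_seq_le (fun k => Rabs (u (k + n)%nat x - u n x))
       (fun _ => (b - a) * (/ 2) ^ n) (Rabs (p x - u n x)) ((b - a) * (/ 2) ^ n)).
    - intros k. rewrite Nat.add_comm. apply Hcau.
    - apply (is_lim_seq_abs _ (Finite (p x - u n x))).
      apply is_lim_seq_minus'; [|apply is_lim_seq_const].
      apply (is_lim_seq_incr_n (fun k => u k x) n). apply Hp.
    - apply is_lim_seq_const. }
  assert (Sp : S p).
  { split.
    - intros x. apply (CVU_continuity u p x (mkposreal 1 Rlt_0_1)).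
      + intros e He.
        destruct (half_pow_small (b - a) e) as [N HN]; [lra|exact He|].
        exists N. intros n y Hn _. eapply Rle_lt_trans; [apply Hup|]. now apply HN.
      + intros n y _. apply HS.
      + unfold Boule. simpl. rewrite Rminus_diag, Rabs_R0. lra.
    - intros x. split.
      + apply (is_lim_seq_le (fun _ => a) (fun n => u n x) a (p x));
          [intros n; apply HS|apply is_lim_seq_const|apply Hp].
      + apply (is_lim_seq_le (fun n => u n x) (fun _ => b) (p x) b);
          [intros n; apply HS|apply Hp|apply is_lim_seq_const]. }
  exists p. split; [exact Sp|]. intros x.
  cut (Rabs (T p x - p x) <= 0).
  { intros H. pose proof (Rabs_pos (T p x - p x)).
    apply Rminus_diag_uniq. apply Rabs_eq_0. lra. }
  apply (nonpos_of_le_half_pow _ (b - a)). intros n.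
  (* Both [T p] and [p] are within [(b - a) / 2 ^ (n + 1)] of [u (n + 1) = T (u n)]. *)
  assert (H1 := Hc p (u n) _ Sp (HS n) (Hup n) x).
  assert (H2 := Hup (Datatypes.S n) x). simpl in H2.
  fold (u n) in H2.
  apply Rabs_le_between in H1, H2. apply Rabs_le.
  change (u (Datatypes.S n) x) with (T (u n) x) in H2. lra.
Qed.

(** * The cone around the solution and the choice of the step *)

Definition in_cone (psi1 t u : R) : Prop := psi1 / 4 * t <= u <= 2 * psi1 * t.

(* For slopes between [psi1 / 4] and [2 * psi1], [psi] stays in a cone with apex
   [(r0, 0)]; there the singular factor of (iii) is absorbed by the opening of
   the cone, so that [f] is Lipschitz in the slope. *)
Record admissible_step (f : R -> R) (psi1 e L : R) : Prop := {
  step_pos : 0 < e;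
  step_le_1 : e <= 1;
  slope_pos : 0 < psi1;
  step_le_slope : 8 * e <= psi1;
  lip_pos : 0 <= L;
  step_lip : 4 * L * e <= 1;
  cone_bound : forall t u, 0 <= t <= e -> in_cone psi1 t u -> Rabs (f u) <= 1;
  cone_lipschitz : forall t d u v, 0 <= t <= e -> 0 <= d ->
    in_cone psi1 t u -> in_cone psi1 t v -> Rabs (u - v) <= d * t ->
    Rabs (f u - f v) <= L * d
}.

(** With [k = psi1 / 4], points of the cone at time [t > 0] are at least [k * t], so (iii) bounds
    the difference of [f] by [C / sqrt (k * t) * (d * t) = L * d * sqrt t], where [L = C / sqrt k];
    and [sqrt t <= 1]. *)
Lemma admissible_step_exists (f : R -> R) (C delta psi1 : R) :
  continuity f -> 0 < C -> 0 < delta -> f 0 = 0 ->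
  (forall u v, punctured delta u -> punctured delta v -> u * v > 0 ->
     Rabs (f u - f v) <= C / sqrt (Rmin (Rabs u) (Rabs v)) * Rabs (u - v)) ->
  0 < psi1 -> exists e L, admissible_step f psi1 e L.
Proof.
  intros hf hC hdelta h1 h3 hpsi.
  destruct (hf 0 1 Rlt_0_1) as [alp [Ha Hy]].
  simpl in Hy. unfold Rdist in Hy. rewrite h1 in Hy.
  assert (Hbd : forall u, Rabs u < alp -> Rabs (f u) <= 1).
  { intros u Hu. destruct (Req_dec 0 u) as [<-|Hn].
    - rewrite h1, Rabs_R0. lra.
    - left. rewrite <- (Rminus_0_r (f u)). apply Hy.
      rewrite Rminus_0_r. split; [split; [exact I|exact Hn]|exact Hu]. }
  set (k := psi1 / 4).
  assert (Hk : 0 < k) by (unfold k; lra).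
  assert (Hsk := sqrt_lt_R0 k Hk).
  set (L := C / sqrt k).
  assert (HL : 0 < L) by (apply Rdiv_lt_0_compat; assumption).
  (* The first three entries are conditions of the record. The last two bound the top [2 * psi1 * e]
     of the cone: by [alp / 2], where continuity at [0] gives [Rabs (f u) <= 1], and by [delta],
     where (iii) holds. *)
  set (e := Rmin (Rmin 1 (psi1 / 8))
              (Rmin (/ (4 * L)) (Rmin (alp / (4 * psi1)) (delta / (2 * psi1))))).
  assert (He1 : e <= Rmin 1 (psi1 / 8)) by apply Rmin_l.
  assert (He2 : e <= Rmin (/ (4 * L)) (Rmin (alp / (4 * psi1)) (delta / (2 * psi1))))
    by apply Rmin_r.
  pose proof (Rmin_l 1 (psi1 / 8)). pose proof (Rmin_r 1 (psi1 / 8)).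
  assert (He3 := Rle_trans _ _ _ He2 (Rmin_l _ _)).
  assert (He4 := Rle_trans _ _ _ He2 (Rmin_r _ _)).
  assert (He5 := Rle_trans _ _ _ He4 (Rmin_l _ _)).
  assert (He6 := Rle_trans _ _ _ He4 (Rmin_r _ _)).
  apply (Rmult_le_compat_r (4 * L)) in He3; [|lra].
  rewrite Rinv_l in He3 by lra.
  apply (Rmult_le_compat_r (4 * psi1)) in He5; [|lra].
  replace (alp / (4 * psi1) * (4 * psi1)) with alp in He5 by (field; lra).
  apply (Rmult_le_compat_r (2 * psi1)) in He6; [|lra].
  replace (delta / (2 * psi1) * (2 * psi1)) with delta in He6 by (field; lra).
  assert (Hepos : 0 < e).
  { unfold e. repeat apply Rmin_pos; try lra; try apply Rdiv_lt_0_compat; try lra.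
    apply Rinv_0_lt_compat. lra. }
  clearbody e. exists e, L. split; try lra.
  - intros t u Ht [Hu1 Hu2]. fold k in Hu1. apply Hbd.
    rewrite Rabs_pos_eq by nra. nra.
  - intros t d u v Ht Hd0 [Hu1 Hu2] [Hv1 Hv2] Hd. fold k in Hu1, Hv1.
    (* At the apex, where (iii) says nothing, both points are [0]. *)
    destruct (Req_dec t 0) as [->|Ht0].
    + replace u with v by lra. rewrite Rminus_diag, Rabs_R0.
      nra.
    + assert (Htp : 0 < t) by lra.
      assert (Hkt : 0 < k * t) by nra.
      assert (Hub : 2 * psi1 * t <= delta) by nra.
      eapply Rle_trans.
      { apply h3; try (right; lra). apply Rmult_gt_0_compat; lra. }
      rewrite (Rabs_pos_eq u), (Rabs_pos_eq v) by lra.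
      assert (Hmin : k * t <= Rmin u v) by (apply Rmin_glb; lra).
      assert (Hst := sqrt_lt_R0 t Htp).
      assert (Hs1 : sqrt t <= 1).
      { rewrite <- sqrt_1. apply sqrt_le_1; lra. }
      assert (Hsq : sqrt k * sqrt t <= sqrt (Rmin u v)).
      { rewrite <- sqrt_mult by lra. apply sqrt_le_1; lra. }
      assert (Hss : sqrt t * sqrt t = t) by (apply sqrt_sqrt; lra).
      apply Rle_trans with (C / (sqrt k * sqrt t) * (d * t)).
      { apply Rmult_le_compat; [|apply Rabs_pos| |exact Hd].
        - apply Rlt_le, Rdiv_lt_0_compat; [lra|]. apply sqrt_lt_R0. lra.
        - apply Rmult_le_compat_l; [lra|].
          apply Rinv_le_contravar; [|exact Hsq]. now apply Rmult_lt_0_compat. }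
      replace (d * t) with (d * (sqrt t * sqrt t)) by (rewrite Hss; ring).
      replace (C / (sqrt k * sqrt t) * (d * (sqrt t * sqrt t))) with (L * d * sqrt t)
        by (unfold L; field; lra).
      rewrite <- (Rmult_1_r (L * d)) at 2. apply Rmult_le_compat_l; [nra|exact Hs1].
Qed.

(** * A priori bounds and uniqueness of the slope *)

(** The body of [is_solution] with its witnesses exposed, so that slopes of two solutions can be
    compared. *)
Definition solution_on (f : R -> R) (r0 psi1 r1 : R) (psi dpsi d2psi : R -> R) : Prop :=
  (forall r, Ico r0 r1 r ->
     D_in psi dpsi (Ico r0 r1) r /\
     D_in dpsi d2psi (Ico r0 r1) r /\
     d2psi r + dpsi r / r + f (psi r) = 0) /\
  dpsi r0 = psi1 /\
  psi r0 = 0.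

(** The mean value point lies strictly before [r], so slope bounds before [r] suffice; this is what
    [bootstrap_bounds] supplies. *)
Lemma solution_in_cone (f : R -> R) (r0 psi1 r1 : R) (psi dpsi d2psi : R -> R) (r : R) :
  solution_on f r0 psi1 r1 psi dpsi d2psi -> Ico r0 r1 r ->
  (forall s, r0 <= s < r -> psi1 / 4 <= dpsi s <= 2 * psi1) ->
  in_cone psi1 (r - r0) (psi r).
Proof.
  intros [Hs [_ H0]] [Hr0 Hr1] Hb. unfold in_cone.
  destruct (Req_dec r0 r) as [<-|Hne]; [rewrite H0; lra|].
  destruct (D_in_mean_value psi dpsi r0 r1 r) as [c [Hc E]];
    [intros x Hx; apply (Hs x Hx)|lra|].
  specialize (Hb c ltac:(lra)). rewrite H0 in E. nra.
Qed.

(** The equation multiplied by [r] is in divergence form, [(r psi')' = - r f(psi)], which absorbs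
    the first-order term. *)
Lemma solution_flux (f : R -> R) (r0 psi1 r1 : R) (psi dpsi d2psi : R -> R) :
  solution_on f r0 psi1 r1 psi dpsi d2psi -> 0 < r0 ->
  forall r, Ico r0 r1 r ->
  D_in (fun x => x * dpsi x) (fun x => - (x * f (psi x))) (Ico r0 r1) r.
Proof.
  intros [Hs _] Hr0 r Hr. destruct (Hs r Hr) as [_ [Hd E]].
  assert (H := Dmult _ _ _ _ _ _ (Dx (Ico r0 r1) r) Hd).
  unfold D_in in *.
  replace (- (r * f (psi r))) with (1 * dpsi r + r * d2psi r); [exact H|].
  unfold Ico in Hr. apply (f_equal (Rmult r)) in E. field_simplify in E; lra.
Qed.

Lemma solution_slope_bounds (f : R -> R) (r0 psi1 e L eta : R) (psi dpsi d2psi : R -> R) :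
  admissible_step f psi1 e L -> 1 <= r0 -> eta <= e ->
  solution_on f r0 psi1 (r0 + eta) psi dpsi d2psi ->
  forall r, Ico r0 (r0 + eta) r -> psi1 / 4 <= dpsi r <= 2 * psi1.
Proof.
  intros HA Hr0 Heta Hsol.
  destruct HA as [A1 A2 A3 A4 A5 A6 A7 _].
  apply (bootstrap_bounds dpsi d2psi); [intros x Hx; apply (proj1 Hsol x Hx)|].
  intros r [Hr1 Hr2] Hb.
  destruct (Req_dec r0 r) as [<-|Hne].
  { destruct Hsol as [_ [-> _]]. lra. }
  destruct (D_in_mean_value _ _ r0 (r0 + eta) r
    (solution_flux _ _ _ _ _ _ _ Hsol ltac:(lra)) ltac:(lra)) as [c [Hc E]].
  assert (Hcone : in_cone psi1 (c - r0) (psi c)).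
  { apply (solution_in_cone f r0 psi1 (r0 + eta) psi dpsi d2psi); [exact Hsol|split; lra|].
    intros s Hs. apply Hb. lra. }
  assert (Hf := A7 (c - r0) (psi c) ltac:(lra) Hcone).
  apply Rabs_le_between in Hf. simpl in E.
  rewrite (proj1 (proj2 Hsol)) in E.
  (* Here [c <= r0 + e <= 2 * r0] and [f] is bounded by [1]. Since [8 * e <= psi1], the flux
     [r * dpsi r] stays between [3/4] and [5/4] of [r0 * psi1]; with [r0 <= r <= 2 * r0] this puts
     the slope strictly inside its bounds. *)
  assert (Hk : - (2 * r0 * e) <= - (c * f (psi c)) * (r - r0) <= 2 * r0 * e).
  { assert (- (2 * r0) <= c * f (psi c) <= 2 * r0) by (split; nra). split; nra. }
  split; nra.
Qed.

(** A uniform bound [d] on the difference of the slopes improves to [d / 2]. Two mean values do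
    this: one turns the slope difference into a difference of [f], the other bounds [psi - phi] by
    [d * (c - r0)], as [cone_lipschitz] needs. *)
Lemma solution_slopes_agree (f : R -> R) (r0 psi1 e L eta : R)
    (psi dpsi d2psi phi dphi d2phi : R -> R) :
  admissible_step f psi1 e L -> 1 <= r0 -> eta <= e ->
  solution_on f r0 psi1 (r0 + eta) psi dpsi d2psi ->
  solution_on f r0 psi1 (r0 + eta) phi dphi d2phi ->
  forall r, Ico r0 (r0 + eta) r -> dpsi r = dphi r.
Proof.
  intros HA Hr0 Heta Hpsi Hphi r Hr.
  assert (Bpsi := solution_slope_bounds f r0 psi1 e L eta psi dpsi d2psi HA Hr0 Heta Hpsi).
  assert (Bphi := solution_slope_bounds f r0 psi1 e L eta phi dphi d2phi HA Hr0 Heta Hphi).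
  destruct HA as [A1 A2 A3 A4 A5 A6 _ A8].
  cut (Rabs (dpsi r - dphi r) <= 0).
  { intros H. pose proof (Rabs_pos (dpsi r - dphi r)).
    apply Rminus_diag_uniq, Rabs_eq_0. lra. }
  apply (nonpos_of_le_half_pow _ (2 * psi1)). intros n.
  revert r Hr. induction n as [|n IH]; intros r Hr.
  { specialize (Bpsi r Hr); specialize (Bphi r Hr). simpl. apply Rabs_le. lra. }
  set (d := 2 * psi1 * (/ 2) ^ n) in *.
  assert (Hd : 0 <= d).
  { unfold d. assert (0 < (/ 2) ^ n) by (apply pow_lt; lra). nra. }
  replace (2 * psi1 * (/ 2) ^ S n) with (d / 2) by (unfold d; simpl; field).
  destruct Hr as [Hr1 Hr2].
  assert (E0 : dpsi r0 = dphi r0).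
  { rewrite (proj1 (proj2 Hpsi)), (proj1 (proj2 Hphi)). reflexivity. }
  destruct (Req_dec r0 r) as [<-|Hne].
  { rewrite E0, Rminus_diag, Rabs_R0. lra. }
  destruct (D_in_mean_value (fun x => x * dpsi x - x * dphi x)
     (fun x => - (x * f (psi x)) - - (x * f (phi x))) r0 (r0 + eta) r) as [c [Hc E]].
  { intros x Hx. apply Dminus.
    - apply (solution_flux f r0 psi1 _ psi dpsi d2psi); [exact Hpsi|lra|exact Hx].
    - apply (solution_flux f r0 psi1 _ phi dphi d2phi); [exact Hphi|lra|exact Hx]. }
  { lra. }
  destruct (D_in_mean_value (fun x => psi x - phi x) (fun x => dpsi x - dphi x)
     r0 (r0 + eta) c) as [b [Hb E']].
  { intros x Hx. apply Dminus; [apply (proj1 Hpsi x Hx)|apply (proj1 Hphi x Hx)]. }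
  { lra. }
  assert (Hf : Rabs (f (psi c) - f (phi c)) <= L * d).
  { apply (A8 (c - r0)); [lra|exact Hd| | |].
    - apply (solution_in_cone f r0 psi1 (r0 + eta) psi dpsi d2psi);
        [exact Hpsi|split; lra|]. intros s Hs. apply Bpsi. split; lra.
    - apply (solution_in_cone f r0 psi1 (r0 + eta) phi dphi d2phi);
        [exact Hphi|split; lra|]. intros s Hs. apply Bphi. split; lra.
    - rewrite (proj2 (proj2 Hpsi)), (proj2 (proj2 Hphi)) in E'.
      replace (psi c - phi c) with ((dpsi b - dphi b) * (c - r0)) by lra.
      rewrite Rabs_mult, (Rabs_pos_eq (c - r0)) by lra.
      apply Rmult_le_compat_r; [lra|]. apply IH. split; lra. }
  rewrite E0 in E.
  replace (dpsi r - dphi r) with (- (c / r) * (f (psi c) - f (phi c)) * (r - r0)).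
  2:{ apply (Rmult_eq_reg_l r); [|lra].
      transitivity (r * dpsi r - r * dphi r - (r0 * dphi r0 - r0 * dphi r0)); [|ring].
      rewrite E. field. lra. }
  assert (Hcr : 0 <= c / r <= 1).
  { split; [apply Rlt_le, Rdiv_lt_0_compat; lra|].
    apply (Rmult_le_reg_r r); [lra|]. unfold Rdiv.
    rewrite Rmult_assoc, Rinv_l by lra. lra. }
  rewrite !Rabs_mult, Rabs_Ropp, (Rabs_pos_eq (c / r)), (Rabs_pos_eq (r - r0)) by lra.
  pose proof (Rabs_pos (f (psi c) - f (phi c))).
  (* [4 * L * e <= 1] makes this at most [d / 4]. *)
  apply Rle_trans with (1 * (L * d) * e); [|nra].
  apply Rmult_le_compat; [nra|lra| |lra].
  apply Rmult_le_compat; lra.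
Qed.

(** * The Picard operator for the slope and existence *)

Definition clamp (a b x : R) : R := Rmax a (Rmin x b).

Lemma clamp_bounds (a b x : R) : a <= b -> a <= clamp a b x <= b.
Proof.
  intros H. unfold clamp. split; [apply Rmax_l|].
  apply Rmax_lub; [exact H|apply Rmin_r].
Qed.

Lemma clamp_id (a b x : R) : a <= x <= b -> clamp a b x = x.
Proof. intros H. unfold clamp. rewrite Rmin_left, Rmax_right; lra. Qed.

Lemma continuity_clamp (a b : R) : continuity (clamp a b).
Proof.
  intros x e He. exists e. split; [exact He|].
  intros y [_ Hy]. simpl in *. unfold Rdist, clamp in *.
  apply Rabs_def2 in Hy.
  unfold Rmax, Rmin. destruct (Rle_dec y b), (Rle_dec x b).
  all: repeat match goal with |- context [Rle_dec ?u ?v] => destruct (Rle_dec u v) end.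
  all: apply Rabs_def1; lra.
Qed.

(** The value of [x psi'(x)] obtained by integrating the divergence form, with [psi] replaced by the
    primitive of [p]. *)
Definition flux (f : R -> R) (r0 psi1 : R) (p : R -> R) (x : R) : R :=
  r0 * psi1 - RInt (fun s => s * f (RInt p r0 s)) r0 x.

(** Clamping freezes the values outside [[r0, r0 + e]], so that continuity and bounds hold on the
    whole line, as the fixed point theorem asks, and the denominator is at least [r0]. *)
Definition picard (f : R -> R) (r0 psi1 e : R) (p : R -> R) (x : R) : R :=
  flux f r0 psi1 p (clamp r0 (r0 + e) x) / clamp r0 (r0 + e) x.

Lemma continuity_source (f p : R -> R) (r0 : R) :
  continuity f -> continuity p -> continuity (fun s => s * f (RInt p r0 s)).
Proof.
  intros Hf Hp.
  apply (continuity_mult (fun s => s) (fun s => f (RInt p r0 s))).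
  - apply derivable_continuous, derivable_id.
  - apply (continuity_comp (fun s => RInt p r0 s) f); [|exact Hf].
    now apply continuity_primitive.
Qed.

Lemma is_derive_flux (f p : R -> R) (r0 psi1 x : R) :
  continuity f -> continuity p ->
  is_derive (flux f r0 psi1 p) x (- (x * f (RInt p r0 x))).
Proof.
  intros Hf Hp. unfold flux.
  replace (- (x * f (RInt p r0 x))) with (0 - x * f (RInt p r0 x)) by ring.
  apply (is_derive_minus (V := R_NormedModule) (fun _ => r0 * psi1)).
  - apply (is_derive_const (V := R_NormedModule)).
  - apply (is_derive_primitive (fun s => s * f (RInt p r0 s))).
    now apply continuity_source.
Qed.

Lemma flux_start (f p : R -> R) (r0 psi1 : R) : flux f r0 psi1 p r0 = r0 * psi1.
Proof.
  unfold flux. rewrite RInt_point. unfold zero; simpl. ring.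
Qed.

Lemma primitive_in_cone (psi1 r0 r : R) (p : R -> R) :
  continuity p -> (forall x, psi1 / 4 <= p x <= 2 * psi1) -> r0 <= r ->
  in_cone psi1 (r - r0) (RInt p r0 r).
Proof.
  intros Hp Hb Hr.
  destruct (is_derive_increment (fun y => RInt p r0 y) p r0 r) as [c [Hc E]];
    [intros; now apply is_derive_primitive|exact Hr|].
  rewrite RInt_point in E. unfold zero in E; simpl in E.
  specialize (Hb c). unfold in_cone. nra.
Qed.

(** The estimate of [solution_slope_bounds] again, without continuous induction because [p] is
    bounded from the start. *)
Lemma picard_bounds (f : R -> R) (r0 psi1 e L : R) (p : R -> R) :
  admissible_step f psi1 e L -> 1 <= r0 -> continuity f ->
  continuity p -> (forall x, psi1 / 4 <= p x <= 2 * psi1) ->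
  forall x, psi1 / 4 <= picard f r0 psi1 e p x <= 2 * psi1.
Proof.
  intros HA Hr0 Hf Hp Hb x.
  destruct HA as [A1 A2 A3 A4 A5 A6 A7 _].
  unfold picard. set (y := clamp r0 (r0 + e) x).
  assert (Hy : r0 <= y <= r0 + e) by (apply clamp_bounds; lra).
  clearbody y.
  destruct (is_derive_increment (flux f r0 psi1 p) _ r0 y
    (fun z => is_derive_flux f p r0 psi1 z Hf Hp) ltac:(lra)) as [c [Hc E]].
  rewrite flux_start in E.
  assert (Hfc := A7 (c - r0) _ ltac:(lra)
    (primitive_in_cone psi1 r0 c p Hp Hb ltac:(lra))).
  apply Rabs_le_between in Hfc. set (w := f (RInt p r0 c)) in *. clearbody w.
  assert (Hk : - (2 * r0 * e) <= - (c * w) * (y - r0) <= 2 * r0 * e).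
  { assert (- (2 * r0) <= c * w <= 2 * r0) by (split; nra). split; nra. }
  split; [apply -> Rle_div_r|apply <- Rle_div_l]; try lra; nra.
Qed.

Lemma continuity_picard (f : R -> R) (r0 psi1 e : R) (p : R -> R) :
  0 <= e -> 1 <= r0 -> continuity f -> continuity p ->
  continuity (picard f r0 psi1 e p).
Proof.
  intros He Hr0 Hf Hp.
  apply (continuity_div (fun x => flux f r0 psi1 p (clamp r0 (r0 + e) x))
     (clamp r0 (r0 + e))).
  - apply (continuity_comp (clamp r0 (r0 + e)) (flux f r0 psi1 p));
      [apply continuity_clamp|].
    intros x. apply continuity_pt_filterlim.
    apply (ex_derive_continuous (flux f r0 psi1 p)). eexists.
    now apply is_derive_flux.
  - apply continuity_clamp.
  - intros x. pose proof (clamp_bounds r0 (r0 + e) x ltac:(lra)). lra.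
Qed.

(** The two mean values of [solution_slopes_agree], applied to fluxes and primitives; the common
    initial flux cancels. *)
Lemma picard_contraction (f : R -> R) (r0 psi1 e L : R) (p q : R -> R) (d : R) :
  admissible_step f psi1 e L -> 1 <= r0 -> continuity f ->
  continuity p -> (forall x, psi1 / 4 <= p x <= 2 * psi1) ->
  continuity q -> (forall x, psi1 / 4 <= q x <= 2 * psi1) ->
  (forall x, Rabs (p x - q x) <= d) ->
  forall x, Rabs (picard f r0 psi1 e p x - picard f r0 psi1 e q x) <= d / 2.
Proof.
  intros HA Hr0 Hf Hp Bp Hq Bq Hd x.
  destruct HA as [A1 A2 A3 A4 A5 A6 _ A8].
  unfold picard. set (y := clamp r0 (r0 + e) x).
  assert (Hy : r0 <= y <= r0 + e) by (apply clamp_bounds; lra).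
  clearbody y.
  assert (Hd0 : 0 <= d). { eapply Rle_trans; [apply Rabs_pos|apply (Hd 0)]. }
  destruct (is_derive_increment (fun z => flux f r0 psi1 p z - flux f r0 psi1 q z)
     (fun z => - (z * f (RInt p r0 z)) - - (z * f (RInt q r0 z))) r0 y) as [c [Hc E]].
  { intros z. apply (is_derive_minus (V := R_NormedModule));
      now apply is_derive_flux. }
  { lra. }
  destruct (is_derive_increment (fun z => RInt p r0 z - RInt q r0 z)
     (fun z => p z - q z) r0 c) as [b [Hb E']].
  { intros z. apply (is_derive_minus (V := R_NormedModule));
      now apply is_derive_primitive. }
  { lra. }
  rewrite !RInt_point in E'. rewrite !flux_start in E.
  assert (HL : Rabs (f (RInt p r0 c) - f (RInt q r0 c)) <= L * d).
  { apply (A8 (c - r0)); [lra|exact Hd0| | |].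
    - apply primitive_in_cone; [exact Hp|exact Bp|lra].
    - apply primitive_in_cone; [exact Hq|exact Bq|lra].
    - replace (RInt p r0 c - RInt q r0 c) with ((p b - q b) * (c - r0)) by lra.
      rewrite Rabs_mult, (Rabs_pos_eq (c - r0)) by lra.
      apply Rmult_le_compat_r; [lra|apply Hd]. }
  replace (flux f r0 psi1 p y / y - flux f r0 psi1 q y / y)
    with (- (c / y) * (f (RInt p r0 c) - f (RInt q r0 c)) * (y - r0)).
  2:{ transitivity ((flux f r0 psi1 p y - flux f r0 psi1 q y
         - (r0 * psi1 - r0 * psi1)) / y); [|field; lra].
      rewrite E. field. lra. }
  assert (Hcy : 0 <= c / y <= 1).
  { split; [apply Rlt_le, Rdiv_lt_0_compat; lra|].
    apply (Rmult_le_reg_r y); [lra|]. unfold Rdiv.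
    rewrite Rmult_assoc, Rinv_l by lra. lra. }
  rewrite !Rabs_mult, Rabs_Ropp, (Rabs_pos_eq (c / y)), (Rabs_pos_eq (y - r0)) by lra.
  pose proof (Rabs_pos (f (RInt p r0 c) - f (RInt q r0 c))).
  apply Rle_trans with (1 * (L * d) * e); [|nra].
  apply Rmult_le_compat; [nra|lra| |lra].
  apply Rmult_le_compat; lra.
Qed.

Lemma solution_exists (f : R -> R) (r0 psi1 e L : R) :
  admissible_step f psi1 e L -> 1 <= r0 -> continuity f ->
  exists psi, is_solution f r0 psi1 (r0 + e) psi.
Proof.
  intros HA Hr0 Hf.
  assert (A1 := step_pos _ _ _ _ HA). assert (A3 := slope_pos _ _ _ _ HA).
  destruct (half_contraction_fixed_point (psi1 / 4) (2 * psi1) (picard f r0 psi1 e))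
    as [p [[Hp Bp] Hfix]].
  { lra. }
  { intros p [Hp Bp]. split; [now apply continuity_picard; [lra|..]|].
    now apply (picard_bounds f r0 psi1 e L). }
  { intros p q d [Hp Bp] [Hq Bq] Hd.
    now apply (picard_contraction f r0 psi1 e L). }
  exists (fun x => RInt p r0 x).
  (* This equals [p] on the interval, but [p] is constant to the left of [r0] and need not have a
     two-sided derivative there, whereas the quotient does. The second derivative below is the
     quotient rule. *)
  exists (fun x => flux f r0 psi1 p x / x).
  exists (fun x => (- (x * f (RInt p r0 x)) * x - flux f r0 psi1 p x * 1) / x ^ 2).
  assert (Hpf : forall r, Ico r0 (r0 + e) r -> p r = flux f r0 psi1 p r / r).
  { intros r [Hr1 Hr2]. rewrite <- Hfix at 1. unfold picard.
    rewrite clamp_id by lra. reflexivity. }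
  split; [|split].
  - intros r Hr. split; [|split].
    + apply is_derive_D_in. rewrite <- Hpf by exact Hr.
      now apply is_derive_primitive.
    + apply is_derive_D_in. apply is_derive_div.
      * now apply is_derive_flux.
      * apply (is_derive_id (K := R_AbsRing)).
      * unfold Ico in Hr. lra.
    + unfold Ico in Hr. field. lra.
  - rewrite flux_start. field. lra.
  - apply (RInt_point (V := R_CompleteNormedModule)).
Qed.

(** Letting [eta] range up to [eps] makes uniqueness cover solutions that live only on a shorter
    interval. *)
Theorem theorem1 (f : R -> R) (C delta : R)
  (hf : continuity f)
  (hC : 0 < C) (hdelta : 0 < delta)
  (h1 : f 0 = 0)
  (h2 : forall u, punctured delta u -> u * f u < 0)
  (h3 : forall u v, punctured delta u -> punctured delta v -> u * v > 0 ->
     Rabs (f u - f v) <= C / sqrt (Rmin (Rabs u) (Rabs v)) * Rabs (u - v))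
  (r0 : R) (hr0 : 1 <= r0)
  (psi1 : R) (hpsi1 : 0 < psi1) :
  exists eps : R, 0 < eps /\
    (exists psi : R -> R, is_solution f r0 psi1 (r0 + eps) psi) /\
    (forall eta : R, 0 < eta <= eps ->
     forall psi phi : R -> R,
       is_solution f r0 psi1 (r0 + eta) psi ->
       is_solution f r0 psi1 (r0 + eta) phi ->
       forall r, Ico r0 (r0 + eta) r -> psi r = phi r).
Proof.
  destruct (admissible_step_exists f C delta psi1 hf hC hdelta h1 h3 hpsi1) as [e [L HA]].
  exists e. split; [exact (step_pos _ _ _ _ HA)|].
  split; [now apply (solution_exists f r0 psi1 e L)|].
  intros eta Heta psi phi [dpsi [d2psi Hpsi]] [dphi [d2phi Hphi]] r [Hr1 Hr2].
  destruct (Req_dec r0 r) as [<-|Hne].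
  { rewrite (proj2 (proj2 Hpsi)), (proj2 (proj2 Hphi)). reflexivity. }
  (* Both solutions start at [0] and their slopes agree, so the mean value of the difference
     vanishes. *)
  destruct (D_in_mean_value (fun x => psi x - phi x) (fun x => dpsi x - dphi x)
     r0 (r0 + eta) r) as [c [Hc E]].
  { intros x Hx. apply Dminus; [apply (proj1 Hpsi x Hx)|apply (proj1 Hphi x Hx)]. }
  { lra. }
  rewrite (solution_slopes_agree f r0 psi1 e L eta psi dpsi d2psi phi dphi d2phi
     HA hr0 (proj2 Heta) Hpsi Hphi c ltac:(split; lra)) in E.
  rewrite (proj2 (proj2 Hpsi)), (proj2 (proj2 Hphi)) in E. lra.
Qed.
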